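(* Let $F=(F_1,\dots,F_n)$ be a normalized sequence of linearly independent symmetric matrices in $M_n(k)$ such that $S=S^F$ is an $n$-dimensional Clifford quantum polynomial algebra, and let $A=S/(g_1^2,\dots,g_r^2)$ be a Clifford quadratic complete intersection of length $r$ in $n$ variables, where $g_1,\dots,g_r\in S_1$. Then the map $\Phi:E_S\to X^{(3)}_S=X^{(3)}(F)$, $p\mapsto p*\sigma_S(p)$, restricts to (at most) a double cover $E_A\to X^{(3)}_A$.
   Context: $k$ is an algebraically closed field of characteristic $0$; all algebras are over $k$. For graded right modules $M,N$ over a connected graded algebra $S$, $\underline{\mathrm{Ext}}^i_S(M,N)=\bigoplus_{j\in\mathbb Z}\mathrm{Ext}^i_{\mathrm{grmod}\,S}(M,N(j))$; $H_S(t)=\sum_i(\dim_k S_i)t^i$; $Z(S)$ is the center. A noetherian connected graded algebra $S$ is an $n$-dimensional quantum polynomial algebra if $\mathrm{gldim}\,S=n$, $\underline{\mathrm{Ext}}^i_S(k,S)\cong k(n)$ for $i=n$ and $0$ for $i\neq n$, and $H_S(t)=(1-t)^{-n}$. For a sequence $F=(F_1,\dots,F_n)$ of linearly independent symmetric matrices in $M_n(k)$, the graded Clifford algebra is $$C(F)=k\langle x_1,\dots,x_n,y_1,\dots,y_n\rangle/\Big(x_ix_j+x_jx_i-\sum_{m=1}^n(F_m)_{ij}y_m,\; x_iy_j-y_jx_i,\; y_iy_j-y_jy_i\Big)_{1\le i,j\le n},$$ $\deg x_i=1$, $\deg y_j=2$. An $n$-dimensional Clifford quantum polynomial algebra is an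 $n$-dimensional quantum polynomial algebra isomorphic, as a graded algebra, to some $C(F)$. $F$ is normalized if $(F_i)_{jj}=2\delta_{ij}$ for all $i,j$. $S^F=k\langle x_1,\dots,x_n\rangle/(x_ix_j+x_jx_i-\sum_m(F_m)_{ij}x_m^2)_{1\le i<j\le n}$; when $F$ is normalized and $C(F)$ is a quantum polynomial algebra, $C(F)=S^F$ with $y_m=x_m^2$, and $Z(S^F)_2=\sum_mkx_m^2$. A Clifford quadratic complete intersection of length $r$ in $n$ variables is $S/(f_1,\dots,f_r)$ with $S$ an $n$-dimensional Clifford quantum polynomial algebra and $f_1,\dots,f_r\in Z(S)_2$ a regular sequence (each $f_i$ a non-zero-divisor modulo the previous ones). A quadratic algebra $A=T(V)/(R)$ satisfies (G1) if there is a projective variety (reduced, possibly reducible or empty) $E_A\subset\mathbb P(V^* )$ and $\sigma_A\in\mathrm{Aut}_kE_A$ with $\mathcal V(R)=\{(p,\sigma_A(p))\mid p\in E_A\}\subset\mathbb P(V^* )\times\mathbb P(V^* )$, where $\mathcal V(R)$ is the zero locus of $R$ viewed as bilinear forms; $E_A$ is called the point variety of $A$. It is known that $S$ and $A$ as in the claim satisfy (G1); here $\mathbb P(V^* )=\mathbb P^{n-1}$ with coordinates $x_1,\dots,x_n$. $X^{(s)}(F)=\{(\lambda_1,\dots,\lambda_n)\in\mathbb P^{n-1}\mid\mathrm{rank}(\sum_m\lambda_mF_m)<s\}$. Writing $g_i^2=\sum_ja_{ij}x_j^2\in Z(S)_2$ and $\tilde g_i=\sum_ja_{ij}u_j\in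 k[u_1,\dots,u_n]_1$, the characteristic varieties of $A$ are $X_A^{(s)}=X^{(s)}(F)\cap\mathcal V(\tilde g_1,\dots,\tilde g_r)\subset\mathbb P^{n-1}$. For $p,q$, $p*q=(p_1q_1,\dots,p_nq_n)$. ''(At most) a double cover'' means a surjective morphism of varieties all of whose fibers have at most two points. *)

(* Defs.v *)
From HB Require Import structures.
From mathcomp Require Import all_boot all_order all_algebra perm.
(* The notations of [monalg] clash with those of [mpoly]. *)
From mathcomp Require Import -(notations) monalg.
From mathcomp Require Import mpoly.

Set Implicit Arguments.
Unset Strict Implicit.
Unset Printing Implicit Defensive.

Import GRing.Theory.
Local Open Scope ring_scope.

Definition two_sided_ideal_gen (R : nzRingType) (X : R -> Prop) (x : R) : Prop :=
  exists d (a r b : 'I_d -> R),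
    (forall i, X (r i)) /\ x = \sum_(i < d) a i * r i * b i.

(* [B] is, via [pi], the quotient of [R] by the two-sided ideal generated by [X]. *)
Definition presented_by (R B : nzRingType) (pi : R -> B) (X : R -> Prop) : Prop :=
  (forall b, exists a, pi a = b) /\
  (forall a, pi a = 0 <-> two_sided_ideal_gen X a).

Definition left_ideal (R : nzRingType) (I : R -> Prop) : Prop :=
  [/\ I 0, forall x y, I x -> I y -> I (x + y) & forall a x, I x -> I (a * x)].

Definition left_noetherian (R : nzRingType) : Prop :=
  forall I : R -> Prop, left_ideal I ->
    exists d (b : 'I_d -> R),
      forall x, I x <-> exists c : 'I_d -> R, x = \sum_(i < d) c i * b i.

Definition noetherian (R : nzRingType) : Prop :=
  left_noetherian R /\ left_noetherian R^c.

Definition central_elt (R : nzRingType) (z : R) : Prop := forall s, z * s = s * z.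

(* For central elements being a left or a right non-zero-divisor modulo the
   previous ones is the same thing. *)
Definition regular_sequence (R : nzRingType) (r : nat) (f : 'I_r -> R) : Prop :=
  forall (i : 'I_r) (s : R),
    let J := two_sided_ideal_gen (fun t => exists2 j : 'I_r, (j < i)%N & t = f j) in
    J (f i * s) -> J s.

Definition freeAlg (k : fieldType) (I : choiceType) : lalgType k :=
  @malg (fmonom I) k.

Definition fvar (k : fieldType) (I : choiceType) (i : I) : freeAlg k I :=
  mkmalgU (FMonom [:: i]) 1.

Definition fhomog (k : fieldType) (I : choiceType) (w : I -> nat) (d : nat)
    (f : freeAlg k I) : Prop :=
  forall m : fmonom I, monalg.mcoeff m f != 0 -> (\sum_(i <- m) w i)%N = d.

Definition direct_sum (I : eqType) (V : zmodType) (G : I -> V -> Prop) : Prop :=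
  [/\ forall i, G i 0 /\ (forall u v, G i u -> G i v -> G i (u - v)),
      forall v, exists (s : seq I) (c : I -> V),
        [/\ uniq s, forall i, G i (c i) & v = \sum_(i <- s) c i]
    & forall (s : seq I) (c : I -> V),
        uniq s -> (forall i, G i (c i)) -> \sum_(i <- s) c i = 0 ->
        forall i, i \in s -> c i = 0].

Definition connected_graded (k : fieldType) (S : algType k)
    (G : nat -> S -> Prop) : Prop :=
  [/\ direct_sum G,
      forall i (c : k) s, G i s -> G i (c *: s),
      forall i j s t, G i s -> G j t -> G (i + j)%N (s * t)
    & forall s, G 0%N s <-> exists c : k, s = c%:A].

Record connGradedAlg (k : fieldType) := ConnGradedAlg {
  cga_sort :> algType k;
  cga_deg : nat -> cga_sort -> Prop;
  cga_axioms : connected_graded cga_deg }.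

Arguments cga_deg {k} S i s : rename.

(* [S] is, as a graded algebra, the free algebra on generators of degrees [w]
   modulo the relations [X]. *)
Definition graded_presentation (k : fieldType) (I : choiceType) (w : I -> nat)
    (S : connGradedAlg k) (pi : {lrmorphism freeAlg k I -> S})
    (X : freeAlg k I -> Prop) : Prop :=
  presented_by pi X /\
  (forall d s, cga_deg S d s <-> exists2 f, fhomog w d f & pi f = s).

Definition has_dim (k : fieldType) (V : lmodType k) (W : V -> Prop) (d : nat) : Prop :=
  exists b : 'I_d -> V,
    (forall v, W v <-> exists c : 'I_d -> k, v = \sum_(i < d) c i *: b i) /\
    (forall c : 'I_d -> k, \sum_(i < d) c i *: b i = 0 -> forall i, c i = 0).

(* H_S(t) = (1 - t)^(-n), i.e. (1 - t)^n * H_S(t) = 1 as formal power series. *)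
Definition hilbert_series_inv_pow (k : fieldType) (S : connGradedAlg k) (n : nat) : Prop :=
  exists h : nat -> nat,
    (forall i, has_dim (cga_deg S i) (h i)) /\
    (forall i, \sum_(j < i.+1) ((1 - 'X) ^+ n : {poly int})`_j * (h (i - j)%N)%:Z
               = (i == 0)%:R).

Definition exact_resolution (R : nzRingType) (M : lmodType R)
    (P : nat -> lmodType R) (d : forall i, {linear P i.+1 -> P i})
    (e : {linear P 0%N -> M}) : Prop :=
  [/\ forall y, exists x, e x = y,
      forall x, e x = 0 <-> exists y, d 0%N y = x
    & forall i x, d i x = 0 <-> exists y, d i.+1 y = x].

Definition projective_module (R : nzRingType) (P : lmodType R) : Prop :=
  forall (M N : lmodType R) (f : {linear M -> N}) (h : {linear P -> N}),
    (forall y, exists x, f x = y) ->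
    exists g : {linear P -> M}, forall p, f (g p) = h p.

Definition proj_dim_le (R : nzRingType) (M : lmodType R) (m : nat) : Prop :=
  exists (P : nat -> lmodType R) (d : forall i, {linear P i.+1 -> P i})
         (e : {linear P 0%N -> M}),
    [/\ forall i, projective_module (P i), exact_resolution d e
      & forall i, (m < i)%N -> forall x : P i, x = 0].

Definition left_gldim_eq (R : nzRingType) (n : nat) : Prop :=
  forall m : nat, (forall M : lmodType R, proj_dim_le M m) <-> (n <= m)%N.

(* Right [S]-modules are left modules over the converse ring [S^c]. *)
Record grmod (k : fieldType) (S : connGradedAlg k) := GrMod {
  gm_sort :> lmodType S^c;
  gm_deg : int -> gm_sort -> Prop;
  gm_direct_sum : direct_sum gm_deg;
  gm_act : forall (i : nat) (j : int) (s : S) (m : gm_sort),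
    cga_deg S i s -> gm_deg j m -> gm_deg (j + i%:Z) ((s : S^c) *: m);
  gm_fg : exists d (b : 'I_d -> gm_sort), forall m,
    exists c : 'I_d -> S, m = \sum_(i < d) (c i : S^c) *: b i }.

Arguments gm_deg {k S} M j m : rename.

Definition reg_deg (k : fieldType) (S : connGradedAlg k) (j : int) (s : S) : Prop :=
  if j is Posz d then cga_deg S d s else s = 0.

Section RegularModule.
Variables (k : fieldType) (S : connGradedAlg k).

Lemma reg_direct_sum : direct_sum (V := ((S^c)^o : lmodType S^c)) (@reg_deg k S).
Proof.
have [[sub dec uni] _ _ _] := cga_axioms S.
split.
- case=> [d|d] /=; first exact: sub d.
  by split=> // u v -> ->; rewrite subr0.
- move=> v; have [s [c [us Gc ->]]] := dec v.
  exists (map Posz s), (fun j : int => if j is Posz d then c d else 0); split.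
  + by rewrite map_inj_uniq // => x y [].
  + by case=> [d|d] /=; first exact: Gc.
  + by rewrite big_map.
- move=> s c us Gc sum0.
  pose tn (j : int) : option nat := if j is Posz d then Some d else None.
  have cN d : c (Negz d) = 0 by exact: (Gc (Negz d)).
  have E : \sum_(j <- s) c j = \sum_(d <- pmap tn s) c (Posz d).
    elim: (s) => [|[d|d] t IH]; rewrite ?big_nil //= !big_cons ?IH //.
    by rewrite cN add0r.
  have up : uniq (pmap tn s).
    elim: (s) us => [|[d|d] t IH] //= /andP[nin ut]; rewrite ?IH ?andbT //.
    apply: contra nin; rewrite mem_pmap => /mapP[[e|e] et] //= [->].
    by [].
  have Z := uni (pmap tn s) (fun d => c (Posz d)) up (fun d => Gc (Posz d)).
  rewrite -E in Z; case=> [d|d] ds; last exact: cN.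
  apply: Z => //; rewrite mem_pmap; apply/mapP.
  by exists (Posz d).
Qed.

Lemma reg_act (i : nat) (j : int) (s : S) (m : (S^c)^o) :
  cga_deg S i s -> reg_deg j m -> reg_deg (j + i%:Z) ((s : S^c) *: m : (S^c)^o).
Proof.
have [[sub _ _] _ mulG _] := cga_axioms S.
case: j => [d|d] Gs /= Gm; first exact: (mulG d i m s Gm Gs).
rewrite Gm scaler0; case: (Negz d + i%:Z) => [e|e] //=.
by have [] := sub e.
Qed.

Lemma reg_fg : exists d (b : 'I_d -> (S^c)^o), forall m : (S^c)^o,
  exists c : 'I_d -> S, m = \sum_(i < d) (c i : S^c) *: b i.
Proof.
exists 1%N, (fun=> 1) => m; exists (fun=> m).
rewrite big_ord1.
exact: (esym (mulr1 (m : S^c))).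
Qed.

Definition regular_grmod : grmod S :=
  @GrMod k S ((S^c)^o) (@reg_deg k S) reg_direct_sum reg_act reg_fg.

End RegularModule.

Section Shift.
Variables (k : fieldType) (S : connGradedAlg k) (M : grmod S) (l : int).

(* M(l)_j = M_(l + j) *)
Definition shift_deg (j : int) (m : M) : Prop := gm_deg M (l + j) m.

Lemma shift_direct_sum : direct_sum shift_deg.
Proof.
have [sub dec uni] := gm_direct_sum M.
split=> [i|v|s c us Gc s0 i si].
- exact: sub.
- have [s [c [us Gc ->]]] := dec v.
  exists [seq j - l | j <- s], (fun j => c (l + j)); split=> [|i|].
  + by rewrite map_inj_uniq //; exact: addIr.
  + exact: Gc.
  + by rewrite big_map; apply: eq_bigr => i _; rewrite addrC subrK.
- have := uni [seq l + j | j <- s] (fun j => c (j - l)).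
  rewrite map_inj_uniq; last exact: addrI.
  move=> /(_ us) H.
  have -> : c i = c (l + i - l) by rewrite addrC addKr.
  apply: H.
  + by move=> j; have := Gc (j - l); rewrite /shift_deg addrC subrK.
  + by rewrite big_map -[RHS]s0; apply: eq_bigr => j _; rewrite addrC addKr.
  + exact: map_f.
Qed.

Lemma shift_act (i : nat) (j : int) (s : S) (m : M) :
  cga_deg S i s -> shift_deg j m -> shift_deg (j + i%:Z) ((s : S^c) *: m).
Proof. by rewrite /shift_deg addrA; exact: gm_act. Qed.

Definition shift_grmod : grmod S :=
  @GrMod k S M shift_deg shift_direct_sum shift_act (gm_fg M).

End Shift.

Section GradedExt.
Variables (k : fieldType) (S : connGradedAlg k).

Definition gm_scale (M : grmod S) (c : k) (m : M) : M := (c%:A : S^c) *: m.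

Definition gr_hom (M N : grmod S) (f : M -> N) : Prop :=
  forall j m, gm_deg M j m -> gm_deg N j (f m).

Definition gr_projective (P : grmod S) : Prop :=
  forall (M N : grmod S) (f : {linear M -> N}) (h : {linear P -> N}),
    gr_hom f -> gr_hom h -> (forall y, exists x, f x = y) ->
    exists g : {linear P -> M}, gr_hom g /\ forall p, f (g p) = h p.

Definition gr_proj_resolution (M : grmod S) (P : nat -> grmod S)
    (d : forall i, {linear P i.+1 -> P i}) (e : {linear P 0%N -> M}) : Prop :=
  [/\ forall i, gr_projective (P i), forall i, gr_hom (d i), gr_hom e
    & exact_resolution (P := fun i => gm_sort (P i)) d e].

Section Cohomology.
Variables (P : nat -> grmod S) (d : forall i, {linear P i.+1 -> P i}) (N : grmod S).

Definition gr_cocycle (i : nat) (h : {linear P i -> N}) : Prop :=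
  gr_hom h /\ forall y, h (d i y) = 0.

Definition gr_coboundary (i : nat) : {linear P i -> N} -> Prop :=
  match i with
  | 0%N => fun h => forall x, h x = 0
  | i'.+1 => fun h => exists b : {linear P i' -> N},
               gr_hom b /\ forall x, h x = b (d i' x)
  end.

(* The i-th cohomology of Hom_grmod(P, N) has dimension [q] over [k]:
   the classes of [z] form a basis. *)
Definition gr_cohomology_dim (i q : nat) : Prop :=
  exists z : 'I_q -> {linear P i -> N},
  [/\ forall a, gr_cocycle (z a),
      forall h, gr_cocycle h -> exists (c : 'I_q -> k) (b : {linear P i -> N}),
        gr_coboundary b /\
        forall x, h x = \sum_(a < q) gm_scale (c a) (z a x) + b x
    & forall (c : 'I_q -> k) (b : {linear P i -> N}),
        gr_coboundary b ->
        (forall x, \sum_(a < q) gm_scale (c a) (z a x) = b x) ->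
        forall a, c a = 0].

End Cohomology.

(* dim_k Ext^i_{grmod S}(M, N) = q *)
Definition gr_ext_dim (M N : grmod S) (i q : nat) : Prop :=
  exists (P : nat -> grmod S) (d : forall i, {linear P i.+1 -> P i})
         (e : {linear P 0%N -> M}),
    gr_proj_resolution d e /\ gr_cohomology_dim d N i q.

(* [K] is the trivial graded module k = S / S_{>0} (unique up to isomorphism). *)
Definition is_trivial_grmod (K : grmod S) : Prop :=
  (forall x, gm_deg K 0 x) /\
  (exists2 e : K, e <> 0 & forall x, exists c : k, x = gm_scale c e).

End GradedExt.

(* Ext^i(k, S) = k(n) if i = n, and 0 otherwise: the degree j component of
   Ext^i(k, S) is Ext^i_{grmod S}(k, S(j)), and that of k(n) is k_(n + j). *)
Definition gorenstein_condition (k : fieldType) (S : connGradedAlg k) (n : nat) : Prop :=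
  exists K : grmod S, is_trivial_grmod K /\
    forall (i : nat) (j : int),
      gr_ext_dim K (shift_grmod (regular_grmod S) j) i
        (if (i == n) && (n%:Z + j == 0) then 1%N else 0%N).

Definition quantum_polynomial (k : fieldType) (S : connGradedAlg k) (n : nat) : Prop :=
  [/\ noetherian S, left_gldim_eq S^c n, gorenstein_condition S n
    & hilbert_series_inv_pow S n].

Section Clifford.
Variables (k : fieldType) (n : nat) (F : n.-tuple 'M[k]_n).

Definition symmetric_matrices : Prop := forall m, (tnth F m)^T = tnth F m.

Definition normalized : Prop :=
  forall i j, (tnth F i) j j = 2%:R * (i == j)%:R.

Definition clX (i : 'I_n) : freeAlg k ('I_n + 'I_n)%type := fvar k (inl i).
Definition clY (i : 'I_n) : freeAlg k ('I_n + 'I_n)%type := fvar k (inr i).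

Definition clifford_weight (u : 'I_n + 'I_n) : nat := if u is inl _ then 1 else 2.

Inductive clifford_rel : freeAlg k ('I_n + 'I_n)%type -> Prop :=
| clifford_xx i j : clifford_rel
    (clX i * clX j + clX j * clX i - \sum_(m < n) (tnth F m) i j *: clY m)
| clifford_xy i j : clifford_rel (clX i * clY j - clY j * clX i)
| clifford_yy i j : clifford_rel (clY i * clY j - clY j * clY i).

Inductive SF_rel : freeAlg k 'I_n -> Prop :=
| SF_xx (i j : 'I_n) of (i < j)%N : SF_rel
    (fvar k i * fvar k j + fvar k j * fvar k i
     - \sum_(m < n) (tnth F m) i j *: (fvar k m) ^+ 2).

End Clifford.

Definition clifford_quantum_polynomial (k : fieldType) (S : connGradedAlg k)
    (n : nat) : Prop :=
  quantum_polynomial S n /\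
  exists (F : n.-tuple 'M[k]_n)
         (pi : {lrmorphism freeAlg k ('I_n + 'I_n)%type -> S}),
    [/\ symmetric_matrices F, free F
      & graded_presentation (@clifford_weight n) pi (clifford_rel F)].

Section Projective.
Variable k : fieldType.

(* P^(n-1): the lines of k^n. *)
Definition proj (n : nat) := {U : {vspace 'rV[k]_n} | \dim U == 1%N}.

(* [v] is a vector of homogeneous coordinates of [p]. *)
Definition hcoord (n : nat) (p : proj n) (v : 'rV[k]_n) : Prop :=
  (v != 0) && (v \in val p).

Definition form_zero (n : nat) (f : {mpoly k[n]}) (p : proj n) : Prop :=
  forall v, hcoord p v -> f.@[v 0] = 0.

Definition zariski_closed (n : nat) (X : proj n -> Prop) : Prop :=
  exists I : {mpoly k[n]} -> Prop,
    (forall f, I f -> exists d : nat, f \is d.-homog) /\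
    (forall p, X p <-> forall f, I f -> form_zero f p).

Record variety (n : nat) := Variety {
  var_pts :> proj n -> Prop;
  var_closed : zariski_closed var_pts }.

(* [f] is only relevant on [X], where it is given locally (on the basic open
   sets h <> 0) by forms of the same degree without common zero. *)
Definition is_morphism (m n : nat) (X : variety m) (Y : variety n)
    (f : proj m -> proj n) : Prop :=
  (forall p, X p -> Y (f p)) /\
  (forall p, X p -> exists (h : {mpoly k[m]}) (e d : nat) (G : 'I_n -> {mpoly k[m]}),
     [/\ h \is e.-homog, ~ form_zero h p, forall j, G j \is d.-homog
       & forall q v, X q -> hcoord q v -> h.@[v 0] != 0 ->
           hcoord (f q) (\row_j (G j).@[v 0])]).

Definition is_automorphism (n : nat) (X : variety n) (f : proj n -> proj n) : Prop :=
  is_morphism X X f /\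
  exists g : proj n -> proj n,
    [/\ is_morphism X X g, forall p, X p -> g (f p) = p
      & forall p, X p -> f (g p) = p].

(* A surjective morphism all of whose fibres have at most two points. *)
Definition at_most_double_cover (m n : nat) (X : variety m) (Y : variety n)
    (f : proj m -> proj n) : Prop :=
  [/\ is_morphism X Y f,
      forall q, Y q -> exists2 p, X p & f p = q
    & forall p1 p2 p3, X p1 -> X p2 -> X p3 -> f p1 = f p2 -> f p1 = f p3 ->
        [\/ p1 = p2, p1 = p3 | p2 = p3]].

(* z = p * q, coordinatewise; there is no such [z] when all products vanish. *)
Definition is_hadamard (n : nat) (p q z : proj n) : Prop :=
  forall v w, hcoord p v -> hcoord q w -> hcoord z (\row_i (v 0 i * w 0 i)).

End Projective.

Section PointVariety.
Variables (k : fieldType) (n : nat) (B : lalgType k).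

Definition bilinear_value (f : freeAlg k 'I_n) (v w : 'rV[k]_n) : k :=
  \sum_(i < n) \sum_(j < n) monalg.mcoeff (FMonom [:: i; j]) f * v 0 i * w 0 j.

(* For B = T(V)/(R), via [pi], with V the span of the n variables, R is the kernel
   of [pi] on the tensors of degree 2. *)
Definition zero_locus (pi : freeAlg k 'I_n -> B) (p q : proj k n) : Prop :=
  forall f, fhomog (fun=> 1%N) 2 f -> pi f = 0 ->
    forall v w, hcoord p v -> hcoord q w -> bilinear_value f v w = 0.

(* Condition (G1), witnessed by E_B = [E] and sigma_B = [sigma]. *)
Definition point_variety (pi : freeAlg k 'I_n -> B) (E : variety k n)
    (sigma : proj k n -> proj k n) : Prop :=
  is_automorphism E sigma /\
  (forall p q, zero_locus pi p q <-> E p /\ q = sigma p).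

End PointVariety.

Section CharacteristicVarieties.
Variables (k : fieldType) (n : nat).

Lemma zariski_closedI (X Y : proj k n -> Prop) :
  zariski_closed X -> zariski_closed Y -> zariski_closed (fun p => X p /\ Y p).
Proof.
move=> [I [hI XI]] [J [hJ YJ]]; exists (fun f => I f \/ J f); split.
  by move=> f [/hI|/hJ].
move=> p; rewrite XI YJ; split=> [[HI HJ] f [/HI|/HJ] //|H].
by split=> f If; apply: H; [left|right].
Qed.

Definition rank_locus_pts (F : n.-tuple 'M[k]_n) (s : nat) (p : proj k n) : Prop :=
  forall v, hcoord p v -> (\rank (\sum_(m < n) v 0 m *: tnth F m)%R < s)%N.

Definition linear_locus_pts (r : nat) (a : 'M[k]_(r, n)) (p : proj k n) : Prop :=
  forall v, hcoord p v -> forall i, \sum_(j < n) a i j * v 0 j = 0.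

Lemma linear_locus_closed (r : nat) (a : 'M[k]_(r, n)) :
  zariski_closed (linear_locus_pts a).
Proof.
pose g i : {mpoly k[n]} := \sum_(j < n) a i j *: 'X_j.
have gE i (v : 'rV[k]_n) : (g i).@[v 0] = \sum_(j < n) a i j * v 0 j.
  by rewrite raddf_sum; apply: eq_bigr => j _; rewrite /= mevalZ mevalXU.
exists (fun f => exists i, f = g i); split.
  move=> f [i ->]; exists 1%N; apply: rpred_sum => j _; apply: rpredZ.
  by rewrite dhomogX /= mpoly.mdeg1.
move=> p; split=> [H f [i ->] v pv|H v pv i]; first by rewrite gE; apply: H.
by rewrite -gE; apply: H => //; exists i.
Qed.

Lemma rank_minors (m : nat) (A : 'M[k]_m) (s : nat) :
  (\rank A < s)%N <-> forall f g : 'I_s -> 'I_m, \det (mxsub f g A) = 0.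
Proof.
split=> [rA f g|H].
  apply/eqP; apply: contraLR rA; rewrite -unitfE -unitmxE -leqNgt.
  move=> /mxrank_unit <-.
  have -> : mxsub f g A = rowsub f 1%:M *m A *m colsub g 1%:M.
    by rewrite mul_rowsub_mx mul1mx mulmx_colsub mulmx1 -mxsub_comp /= .
  by rewrite (leq_trans (mxrankM_maxl _ _)) // mxrankM_maxr.
rewrite ltnNge; apply/negP => sr.
pose w : 'I_s -> 'I_(\rank A) := widen_ord sr.
pose C := rowsub (maxrankfun A \o w) A.
have Cfree : row_free C.
  have /row_freeP[X BX] := maxrowsub_free A.
  apply/row_freeP; exists (X *m (rowsub w 1%:M)^T).
  have -> : C = rowsub w (rowsub (maxrankfun A) A) by rewrite -mxsub_comp.
  rewrite mulmxA mul_rowsub_mx BX; apply/matrixP=> i j; rewrite !mxE.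
  rewrite (bigD1 (w i)) //= !mxE eqxx mul1r big1 ?addr0 => [|l li].
    by rewrite -val_eqE /= val_eqE eq_sym.
  by rewrite !mxE eq_sym (negPf li) mul0r.
have Cfull : row_full C^T by rewrite -col_leq_rank mxrank_tr row_leq_rank.
have := mxrank_fullrowsub Cfull.
have -> : rowsub (fullrankfun Cfull) C^T
          = (mxsub (maxrankfun A \o w) (fullrankfun Cfull) A)^T.
  by apply/matrixP=> i j; rewrite !mxE.
move/eqP; rewrite mxrank_tr -/(row_free _) row_free_unit unitmxE H.
by rewrite unitr0.
Qed.

Lemma rank_locus_closed (F : n.-tuple 'M[k]_n) (s : nat) :
  zariski_closed (rank_locus_pts F s).
Proof.
pose M : 'M[{mpoly k[n]}]_n := \matrix_(i, j) \sum_(m < n) (tnth F m) i j *: 'X_m.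
have ME (v : 'rV[k]_n) :
    map_mx (meval (v 0)) M = \sum_(m < n) v 0 m *: tnth F m.
  apply/matrixP=> i j; rewrite !mxE raddf_sum summxE; apply: eq_bigr => m _.
  by rewrite /= mevalZ mevalXU mxE mulrC.
have detE (f g : 'I_s -> 'I_n) (v : 'rV[k]_n) : (\det (mxsub f g M)).@[v 0]
    = \det (mxsub f g (\sum_(m < n) v 0 m *: tnth F m)).
  by rewrite -ME -map_mxsub det_map_mx.
exists (fun q => exists f g : 'I_s -> 'I_n, q = \det (mxsub f g M)); split.
  move=> q [f [g ->]]; exists s; apply: rpred_sum => t _.
  rewrite -signr_odd mulr_sign; set P := \prod_i _.
  suff hP : P \is s.-homog by case: ifP => _ //; rewrite rpredN.
  have hl : all (fun q : {mpoly k[n]} => q \is 1.-homog)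
              [seq mxsub f g M i ((t : 'S_s) i) | i <- index_enum 'I_s].
    apply/allP => x /mapP[i _ ->]; rewrite !mxE; apply: rpred_sum => j _.
    by apply: rpredZ; rewrite dhomogX /= mpoly.mdeg1.
  have sz : size (index_enum 'I_s) = s by rewrite -sum1_size big_const_ord iter_addn_0 mul1n.
  rewrite /P -[X in X.-homog]sz; elim: (index_enum 'I_s) hl => [_|i l IH].
    by rewrite big_nil dhomog1.
  by move=> /= /andP[hi /IH hl]; rewrite big_cons; exact: (dhomogM hi hl).
move=> p; split=> [H q [f [g ->]] v pv|H v pv].
  by rewrite detE; move: f g; apply/rank_minors; apply: H.
by apply/rank_minors => f g; rewrite -detE; apply: H => //; exists f, g.
Qed.

(* X^(s)(F) *)
Definition rank_locus (F : n.-tuple 'M[k]_n) (s : nat) : variety k n :=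
  Variety (rank_locus_closed F s).

(* X_A^(s), the rows of [a] being the coefficients of the linear forms g~_i. *)
Definition char_variety (F : n.-tuple 'M[k]_n) (r : nat) (a : 'M[k]_(r, n))
    (s : nat) : variety k n :=
  Variety (zariski_closedI (rank_locus_closed F s) (linear_locus_closed a)).

End CharacteristicVarieties.

(* Main.v *)
(* A pair of points (p, q) with coordinates (v, w) lies in the zero locus of the
   relations of S if and only if v^T w + w^T v = sum_m v_m w_m F_m: the diagonal
   entries agree because F is normalized.  So p * sigma_S(p) lies in the locus of
   rank at most 2; conversely every nonzero symmetric matrix of rank at most 2 is
   of the form v^T w + w^T v, and unique factorization of the quadratic form
   2 v(x) w(x) says that {p, sigma_S(p)} is determined by p * sigma_S(p).  The
   relations sum_j a_ij x_j^2 of A only add the linear equations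
   sum_j a_ij (v_j w_j) = 0 on p * sigma_S(p). *)
Require Import Defs.
From HB Require Import structures.
From mathcomp Require Import all_boot all_order all_algebra.
From mathcomp Require Import finmap.
From mathcomp Require Import -(notations) monalg.
From mathcomp Require Import mpoly.
From mathcomp Require Import ring.

Set Implicit Arguments.
Unset Strict Implicit.
Unset Printing Implicit Defensive.

Import GRing.Theory.
Local Open Scope ring_scope.

(** * Lowest-degree coefficients of products in the free algebra *)

Section FreeAlgebra.
Variables (k : fieldType) (I : choiceType).
Implicit Types (f a b : freeAlg k I) (m : fmonom I).

Lemma ltn_size_fmonomMl m1 m2 : (size m2 < size (mmul m1 m2))%N = (m1 != mone).
Proof.
rewrite fmM size_cat -fdeg_eq0 fdegE -lt0n.
by rewrite -{1}[size m2]add0n ltn_add2r.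
Qed.

Lemma ltn_size_fmonomMr m1 m2 : (size m1 < size (mmul m1 m2))%N = (m2 != mone).
Proof.
rewrite fmM size_cat -fdeg_eq0 fdegE -lt0n.
by rewrite -{1}[size m1]addn0 ltn_add2l.
Qed.

(** In a factorization of the word [m] with nonempty left factor, the right factor is shorter than
    [m], where [f] has no coefficient; only the empty left factor contributes. *)
Lemma mcoeffM_lowl a f m :
    (forall m', (size m' < size m)%N -> monalg.mcoeff m' f = 0) ->
  monalg.mcoeff m (a * f) = monalg.mcoeff mone a * monalg.mcoeff m f.
Proof.
move=> f0.
(* Enlarging both supports lets the terms at [mone] and [m] be split off even when their
   coefficients vanish. *)
rewrite (@mcoeffMlw _ _ (mone |` monalg.msupp a)%fset (m |` monalg.msupp f)%fset)
  ?fsubsetU1 //.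
rewrite (bigD1_seq mone) ?fset1U1 ?fset_uniq //= [X in _ + X]big1
  ?addr0; last first.
  move=> m1 m1n; apply: big1 => m2 _; case: eqP => [E|]; last by [].
  by rewrite f0 ?mulr0 // -E ltn_size_fmonomMl.
rewrite (bigD1_seq m) ?fset1U1 ?fset_uniq //= monalg.mul1m eqxx.
rewrite mulr1n big1 ?addr0 //.
by move=> m2 /negPf m2n; rewrite monalg.mul1m m2n.
Qed.

Lemma mcoeffM_lowr b f m :
    (forall m', (size m' < size m)%N -> monalg.mcoeff m' f = 0) ->
  monalg.mcoeff m (f * b) = monalg.mcoeff m f * monalg.mcoeff mone b.
Proof.
move=> f0.
rewrite (@mcoeffMrw _ _ (m |` monalg.msupp f)%fset (mone |` monalg.msupp b)%fset)
  ?fsubsetU1 //.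
rewrite (bigD1_seq mone) ?fset1U1 ?fset_uniq //= [X in _ + X]big1
  ?addr0; last first.
  move=> m1 m1n; apply: big1 => m2 _; case: eqP => [E|]; last by [].
  by rewrite f0 ?mul0r // -E ltn_size_fmonomMr.
rewrite (bigD1_seq m) ?fset1U1 ?fset_uniq //= monalg.mulm1 eqxx.
rewrite mulr1n big1 ?addr0 //.
by move=> m2 /negPf m2n; rewrite monalg.mulm1 m2n.
Qed.

Lemma fhomog_low d f m : fhomog (fun=> 1%N) d f -> size m != d ->
  monalg.mcoeff m f = 0.
Proof.
move=> hf; apply: contra_neq_eq => /hf <-.
by rewrite big_const_seq count_predT iter_addn_0 mul1n.
Qed.

(** In the degree of [f] itself, two-sided multiplication only rescales by constant terms, so an
    ideal generated by quadratic relations contains nothing of degree two beyond their span. *)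
Lemma mcoeffM_fhomog a f b d m : fhomog (fun=> 1%N) d f -> size m = d ->
  monalg.mcoeff m (a * f * b)
  = monalg.mcoeff mone a * monalg.mcoeff m f * monalg.mcoeff mone b.
Proof.
move=> hf sm; have f0 m' : (size m' < size m)%N -> monalg.mcoeff m' f = 0.
  by rewrite sm => /ltn_eqF /negbT /(fhomog_low hf).
rewrite mcoeffM_lowr ?mcoeffM_lowl // => m' lm.
by rewrite mcoeffM_lowl ?f0 ?mulr0 // => m'' /ltn_trans/(_ lm)/f0.
Qed.

Lemma fhomogD w d f1 f2 : fhomog w d f1 -> fhomog w d f2 ->
  fhomog w d (f1 + f2 : freeAlg k I).
Proof.
move=> h1 h2 m; rewrite monalg.mcoeffD.
have [->|/h1 //] := eqVneq (monalg.mcoeff m f1) 0.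
by rewrite add0r => /h2.
Qed.

Lemma fhomogZ w d (c : k) f : fhomog w d f -> fhomog w d (c *: f).
Proof.
move=> h m; rewrite monalg.mcoeffZ; have [->|/h //] := eqVneq (monalg.mcoeff m f) 0.
by rewrite mulr0 eqxx.
Qed.

Lemma fhomog_sum w d (J : finType) (g : J -> freeAlg k I) :
  (forall j, fhomog w d (g j)) -> fhomog w d (\sum_j g j).
Proof.
move=> h; elim/big_ind: _ => //; last exact: fhomogD.
by move=> m; rewrite monalg.mcoeff0 eqxx.
Qed.

Lemma fvarM (i j : I) : fvar k i * fvar k j = mkmalgU (FMonom [:: i; j]) 1.
Proof.
rewrite /fvar malgM_def fgmulUU mulr1; congr mkmalgU.
by apply/eqP; rewrite fmP fmM.
Qed.

Lemma fhomog_fvarM (i j : I) : fhomog (fun=> 1%N) 2 (fvar k i * fvar k j).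
Proof.
move=> m; rewrite fvarM monalg.mcoeffU; case: (_ =P m) => [<- _|_]; last by rewrite eqxx.
by rewrite !big_cons big_nil.
Qed.

End FreeAlgebra.

(** * Ideals of relations and iterated quotients *)

Section Presentations.

Lemma ideal_genD (R : nzRingType) (X : R -> Prop) (x y : R) :
  two_sided_ideal_gen X x -> two_sided_ideal_gen X y ->
  two_sided_ideal_gen X (x + y).
Proof.
move=> [d1 [a1 [r1 [b1 [X1 ->]]]]] [d2 [a2 [r2 [b2 [X2 ->]]]]].
pose glue (u1 : 'I_d1 -> R) u2 (i : 'I_(d1 + d2)) :=
  match split i with inl j => u1 j | inr j => u2 j end.
exists (d1 + d2)%N, (glue a1 a2), (glue r1 r2), (glue b1 b2); split.
  by move=> i; rewrite /glue; case: split.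
rewrite big_split_ord /glue; congr (_ + _); apply: eq_bigr => i _.
  by rewrite (unsplitK (inl i)).
by rewrite (unsplitK (inr i)).
Qed.

Lemma ideal_genS (R : nzRingType) (X Y : R -> Prop) (x : R) :
  (forall r, X r -> Y r) -> two_sided_ideal_gen X x -> two_sided_ideal_gen Y x.
Proof.
by move=> XY [d [a [r [b [Xr ->]]]]]; exists d, a, r, b; split=> // i; apply: XY.
Qed.

Lemma presented_by_ker (R B : nzRingType) (pi : R -> B) (X : R -> Prop) (x : R) :
  presented_by pi X -> X x -> pi x = 0.
Proof.
move=> [_ ker] Xx; apply/ker; exists 1%N, (fun=> 1), (fun=> x), (fun=> 1).
by split=> //; rewrite big_ord1 mul1r mulr1.
Qed.

(** An element killed by the composite has its image in the ideal of [Z]; lifting that expression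
    termwise to [s] leaves a difference in the kernel of [pi], hence in the ideal of [X]. *)
Lemma presented_by_comp (R B C : nzRingType) (pi : {rmorphism R -> B})
    (rho : {rmorphism B -> C}) (X Y : R -> Prop) (Z : B -> Prop) :
  presented_by pi X -> presented_by rho Z ->
  (forall z, Z z <-> exists2 y, Y y & pi y = z) ->
  presented_by (fun x => rho (pi x)) (fun x => X x \/ Y x).
Proof.
move=> Xpi Zrho ZY; have [surpi kerpi] := Xpi; have [surrho kerrho] := Zrho.
split=> [c|x].
  by have [b <-] := surrho c; have [x <-] := surpi b; exists x.
split=> [/kerrho [d [a [z [b [Zz E]]]]]|[d [a [y [b [XY ->]]]]]]; last first.
  rewrite !raddf_sum big1 // => i _ /=; rewrite !rmorphM.
  suff -> : rho (pi (y i)) = 0 by rewrite mulr0 mul0r.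
  have [/(presented_by_ker Xpi) ->|Yy] := XY i; first exact: rmorph0.
  by apply: (presented_by_ker Zrho); apply/ZY; exists (y i).
have /fin_all_exists [a' a'E] i := surpi (a i).
have /fin_all_exists [b' b'E] i := surpi (b i).
have /fin_all_exists [y yE] i : exists t : R, Y t /\ pi t = z i.
  by have /ZY [t] := Zz i; exists t.
pose s := \sum_i a' i * y i * b' i.
have /kerpi Ix : pi (x - s) = 0.
  rewrite rmorphB E raddf_sum -sumrB big1 // => i _ /=.
  by rewrite !rmorphM a'E b'E (yE i).2 subrr.
rewrite -[x](subrK s); apply: ideal_genD; first by apply: ideal_genS Ix; left.
by exists d, a', y, b'; split=> // i; right; case: (yE i).
Qed.

End Presentations.

(** * Relations as bilinear forms and their zero locus *)

Section BilinearValue.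
Variables (k : fieldType) (n : nat).
Implicit Types (f : freeAlg k 'I_n) (v w : 'rV[k]_n) (p q : proj k n).

Lemma bilinear_valueD f1 f2 v w :
  bilinear_value (f1 + f2) v w = bilinear_value f1 v w + bilinear_value f2 v w.
Proof.
rewrite /bilinear_value -big_split; apply: eq_bigr => i _ /=.
by rewrite -big_split; apply: eq_bigr => j _ /=; rewrite monalg.mcoeffD !mulrDl.
Qed.

Lemma bilinear_valueZ (c : k) f v w :
  bilinear_value (c *: f) v w = c * bilinear_value f v w.
Proof.
rewrite /bilinear_value mulr_sumr; apply: eq_bigr => i _.
by rewrite mulr_sumr; apply: eq_bigr => j _; rewrite monalg.mcoeffZ !mulrA.
Qed.

Lemma bilinear_valueB f1 f2 v w :
  bilinear_value (f1 - f2) v w = bilinear_value f1 v w - bilinear_value f2 v w.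
Proof.
rewrite bilinear_valueD; congr (_ + _).
by rewrite -(scaleN1r f2) bilinear_valueZ mulN1r.
Qed.

Lemma bilinear_value_sum v w (J : finType) (g : J -> freeAlg k 'I_n) :
  bilinear_value (\sum_j g j) v w = \sum_j bilinear_value (g j) v w.
Proof.
apply: (big_morph (fun f => bilinear_value f v w)).
  by move=> f1 f2; apply: bilinear_valueD.
by rewrite -[0 in LHS](scale0r 0) bilinear_valueZ mul0r.
Qed.

Lemma bilinear_value_fvarM (i j : 'I_n) v w :
  bilinear_value (fvar k i * fvar k j) v w = v 0 i * w 0 j.
Proof.
rewrite /bilinear_value fvarM (bigD1 i) //= (bigD1 j) //= monalg.mcoeffUU mul1r.
rewrite !big1 ?addr0 // => [i' ni|j' nj].
  apply: big1 => j' _; rewrite monalg.mcoeffU; case: eqP => [[E _]|_].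
    by rewrite E eqxx in ni.
  by rewrite !mul0r.
rewrite monalg.mcoeffU; case: eqP => [[E]|_]; last by rewrite !mul0r.
by rewrite E eqxx in nj.
Qed.

(** Only coefficients of words of length two enter the value, and there [a * r * b] is a scalar
    multiple of [r]. *)
Lemma bilinear_value_ideal (X : freeAlg k 'I_n -> Prop) v w :
    (forall r, X r -> fhomog (fun=> 1%N) 2 r /\ bilinear_value r v w = 0) ->
  forall f, two_sided_ideal_gen X f -> bilinear_value f v w = 0.
Proof.
move=> X0 f [d [a [r [b [Xr ->]]]]]; rewrite bilinear_value_sum big1 // => i _.
have [hr r0] := X0 _ (Xr i).
rewrite -[RHS](mulr0 (monalg.mcoeff mone (a i) * monalg.mcoeff mone (b i))) -r0.
rewrite -bilinear_valueZ; apply: eq_bigr => s _; apply: eq_bigr => t _.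
rewrite monalg.mcoeffZ (mcoeffM_fhomog _ _ hr) //; congr (_ * _ * _).
exact: mulrAC.
Qed.

(** Reduces the condition on the whole degree-two kernel to the listed relations. *)
Lemma zero_locusE (B : lalgType k) (pi : freeAlg k 'I_n -> B)
    (X : freeAlg k 'I_n -> Prop) p q :
    presented_by pi X -> (forall r, X r -> fhomog (fun=> 1%N) 2 r) ->
  zero_locus pi p q <->
  forall r, X r -> forall v w, hcoord p v -> hcoord q w -> bilinear_value r v w = 0.
Proof.
move=> Xpi Xh; split=> [pq r Xr|H f _ /Xpi.2 If v w pv qw].
  by apply: pq; [apply: Xh|exact: presented_by_ker Xpi Xr].
apply: bilinear_value_ideal If => r Xr.
by split; [apply: Xh|apply: H].
Qed.

End BilinearValue.

(** * Products of two linear forms as symmetric matrices *)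

Section SymmetricRankTwo.
Variables (k : fieldType) (n : nat).
Hypothesis k2 : 2%:R != 0 :> k.
Implicit Types (v w : 'rV[k]_n).

(** The Gram matrix of the quadratic form 2 v(x) w(x). *)
Definition sym_outer v w : 'M[k]_n := v^T *m w + w^T *m v.

Lemma sym_outerE v w i j : sym_outer v w i j = v 0 i * w 0 j + w 0 i * v 0 j.
Proof. by rewrite !mxE !big_ord1 !mxE. Qed.

Lemma sym_outerZ (b c : k) v w :
  sym_outer (b *: v) (c *: w) = (b * c) *: sym_outer v w.
Proof. by apply/matrixP => i j; rewrite !mxE !big_ord1 !mxE; ring. Qed.

Lemma rank_sym_outer v w : (\rank (sym_outer v w) <= 2)%N.
Proof.
apply: leq_trans (mxrank_add _ _) _; apply: (@leq_add _ _ 1 1).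
  by rewrite (leq_trans (mxrankM_maxr _ _)) ?rank_leq_row.
by rewrite (leq_trans (mxrankM_maxr _ _)) ?rank_leq_row.
Qed.

(** If v_i is nonzero, the diagonal entry 2 v_i w_i kills w_i, and then row i kills the rest of
    [w]. *)
Lemma sym_outer_eq0 v w : sym_outer v w = 0 -> v = 0 \/ w = 0.
Proof.
move=> /matrixP vw0; have [->|] := eqVneq v 0; first by left.
move=> /rV0Pn [i vi]; right; apply/rowP => j.
have vw a b : v 0 a * w 0 b + w 0 a * v 0 b = 0.
  by have := vw0 a b; rewrite sym_outerE => ->; rewrite mxE.
have wi : w 0 i = 0.
  apply/eqP; have := vw i i; rewrite [w 0 i * _]mulrC -mulr2n -mulr_natl.
  by move/eqP; rewrite !mulf_eq0 (negPf k2) (negPf vi).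
have := vw i j; rewrite wi mul0r addr0 mxE => /eqP.
by rewrite mulf_eq0 (negPf vi) => /eqP.
Qed.

(* The vectors [v' 0 i *: e_j - v' 0 j *: e_i] span the kernel of [v'], on which
   the form [sym_outer v' w'], hence also [sym_outer v w], vanishes; so [v] or
   [w] vanishes on this kernel. *)
Lemma sym_outer_factor v w v' w' (c : k) : v' != 0 ->
    sym_outer v w = c *: sym_outer v' w' ->
  exists2 b, b != 0 & exists d, b *: v = d *: v' \/ b *: w = d *: v'.
Proof.
move=> /rV0Pn [i v'i] /matrixP E; exists (v' 0 i) => //.
have EE a b : v 0 a * w 0 b + w 0 a * v 0 b
            = c * (v' 0 a * w' 0 b + w' 0 a * v' 0 b).
  by have := E a b; rewrite sym_outerE mxE sym_outerE.
have /sym_outer_eq0 [/eqP|/eqP] :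
    sym_outer (v' 0 i *: v - v 0 i *: v') (v' 0 i *: w - w 0 i *: v') = 0.
- apply/matrixP => j l; rewrite sym_outerE !mxE.
  transitivity (v' 0 i ^+ 2 * (v 0 j * w 0 l + w 0 j * v 0 l)
    - v' 0 i * v' 0 l * (v 0 j * w 0 i + w 0 j * v 0 i)
    - v' 0 j * v' 0 i * (v 0 i * w 0 l + w 0 i * v 0 l)
    + v' 0 j * v' 0 l * (v 0 i * w 0 i + w 0 i * v 0 i)); first by ring.
  by rewrite !EE; ring.
- by rewrite subr_eq0 => /eqP ->; exists (v 0 i); left.
by rewrite subr_eq0 => /eqP ->; exists (w 0 i); right.
Qed.

End SymmetricRankTwo.

(** * Factorization of symmetric matrices of rank at most two *)

Section ClosedField.
Variables (k : closedFieldType) (n : nat).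
Hypothesis k2 : 2%:R != 0 :> k.

Lemma closed_field_sqrt (c : k) : exists x, x ^+ 2 = c.
Proof.
(* The default value of [nth] supplies the zero coefficient of X. *)
have [x xE] := @solve_monicpoly k 2 (nth 0 [:: c]) isT.
by exists x; rewrite xE !big_ord_recl big_ord0 /= mul0r mulr1 !addr0.
Qed.

(** All 2x2 minors vanish, so N_ij N_aa = N_ia N_aj: row a divided by a square root of N_aa works as
    soon as N_aa is nonzero. *)
Lemma sym_rank1 (N : 'M[k]_n) : N^T = N -> (\rank N <= 1)%N ->
  exists t : 'rV[k]_n, N = t^T *m t.
Proof.
move=> symN rN.
have symE i j : N i j = N j i by rewrite -[in LHS]symN mxE.
have minor a b c d : N a b * N c d = N a d * N c b.
  move: (col_base N) (row_base N) (mulmx_base N) rN.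
  case: (\rank N) => [|[|//]] C R <- _; rewrite !mxE ?big_ord0 ?big_ord1 ?mul0r //.
  by ring.
have [N0|/matrix0Pn [a [b Nab]]] := eqVneq N 0.
  by exists 0; rewrite mulmx0.
(* By symmetry and the vanishing minor, N_ab^2 = N_aa N_bb, so a nonzero entry forces a nonzero
   diagonal one. *)
have Naa : N a a != 0.
  apply: contra_neq Nab => Naa; apply/eqP; rewrite -sqrf_eq0 expr2.
  by rewrite [X in _ * X]symE minor Naa mul0r.
have [s sE] := closed_field_sqrt (N a a).
have s0 : s != 0 by rewrite -sqrf_eq0 sE.
exists (s^-1 *: row a N); apply/matrixP => i j.
rewrite !mxE big_ord1 !mxE mulrACA -invfM -expr2 sE.
by rewrite [N a i]symE [N i a * _]minor mulrC mulfK.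
Qed.

(* Completing the square at a nonzero diagonal entry lowers the rank by one, so
   [M] is a sum [u^2 + t^2] of two squares, which factors as [(u + t) (u - t)]
   up to a square root of [-1]. *)
Lemma sym_rank2_factor (M : 'M[k]_n) (a : 'I_n) :
    M^T = M -> (\rank M <= 2)%N -> M a a != 0 ->
  exists v w : 'rV[k]_n, M = sym_outer v w.
Proof.
move=> symM rM Maa.
have symE i j : M i j = M j i by rewrite -[in LHS]symM mxE.
have [s sE] := closed_field_sqrt (M a a).
have s0 : s != 0 by rewrite -sqrf_eq0 sE.
pose u := s^-1 *: row a M.
pose N := M - u^T *m u.
have NE i j : N i j = M i j - M a i * M a j / M a a.
  by rewrite !mxE big_ord1 !mxE -sE; field.
have symN : N^T = N.
  by rewrite /N linearB /= trmx_mul trmxK symM.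
(* The inclusion is strict because column [a] of [N] vanishes, while row [a] of [M] has the nonzero
   entry M_aa. *)
have ltNM : (N < M)%MS.
  rewrite ltmxE addmx_sub ?eqmx_opp ?mulmx_sub ?scalemx_sub ?row_sub //=.
  apply: contra (Maa) => /(submx_trans (row_sub a M)) /submxP [D DE].
  have := congr1 (fun A : 'rV_n => A 0 a) DE; rewrite [LHS]mxE [RHS]mxE => ->.
  by rewrite big1 // => j _; rewrite NE mulfK // [M j a]symE subrr mulr0.
have [t tE] : exists t : 'rV[k]_n, N = t^T *m t.
  by apply: sym_rank1 => //; rewrite -ltnS (leq_trans (rank_ltmx ltNM)).
have [I IE] := closed_field_sqrt (-1).
(* The factor 1/2 compensates for [sym_outer] counting the product twice. *)
exists (u + I *: t), (2%:R^-1 *: (u - I *: t)).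
rewrite -[M](subrK (u^T *m u)) -/N tE; apply/matrixP => i j.
rewrite sym_outerE !mxE !big_ord1 !mxE.
set ti := t 0 i; set tj := t 0 j; set ui := M a i; set uj := M a j.
transitivity (s^-1 ^+ 2 * ui * uj - I ^+ 2 * ti * tj); first by rewrite IE; ring.
by field; rewrite k2 s0.
Qed.

End ClosedField.

(** * Homogeneous coordinates of points *)

Section Lines.
Variables (k : fieldType) (n : nat).
Implicit Types (p q : proj k n) (v w : 'rV[k]_n).

Lemma hcoord_line p v : hcoord p v -> val p = <[v]>%VS.
Proof.
move=> /andP [v0 vp]; apply/esym/eqP; rewrite eqEdim -memvE vp.
by rewrite dim_vline v0 (eqP (valP p)).
Qed.

Lemma hcoord_vpick p : hcoord p (vpick (val p)).
Proof.
by rewrite /hcoord memv_pick vpick0 andbT -dimv_eq0 (eqP (valP p)).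
Qed.

Lemma hcoord_ex p : exists v, hcoord p v.
Proof. by exists (vpick (val p)); apply: hcoord_vpick. Qed.

Lemma hcoord_eq p q v : hcoord p v -> hcoord q v -> p = q.
Proof. by move=> /hcoord_line pv /hcoord_line qv; apply: val_inj; rewrite pv. Qed.

Lemma hcoord_scale p v w : hcoord p v -> hcoord p w -> exists c, w = c *: v.
Proof.
by move=> /hcoord_line pv /andP [_]; rewrite pv => /vlineP.
Qed.

Lemma hcoordZ p v (c : k) : c != 0 -> hcoord p v -> hcoord p (c *: v).
Proof.
by move=> c0 /andP [v0 vp]; rewrite /hcoord scaler_eq0 negb_or c0 v0 memvZ.
Qed.

Lemma hcoord_collinear p q v w (b c : k) :
  hcoord p v -> hcoord q w -> b != 0 -> b *: v = c *: w -> p = q.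
Proof.
move=> pv qw b0 E; apply: hcoord_eq (hcoordZ b0 pv) _; rewrite E.
apply: hcoordZ qw; apply: contraTneq (hcoordZ b0 pv) => c0.
by rewrite E c0 scale0r /hcoord eqxx.
Qed.

(** The default [p] covers [v = 0], which spans no point; one has to be supplied since the
    projective space is empty for [n = 0]. *)
Definition line_or p v : proj k n := insubd p <[v]>%VS.

Lemma hcoord_line_or p v : v != 0 -> hcoord (line_or p v) v.
Proof.
by move=> v0; rewrite /hcoord v0 insubdK ?memv_line // -topredE /= dim_vline v0.
Qed.

End Lines.

Definition hadamard_row (k : fieldType) (n : nat) (v w : 'rV[k]_n) : 'rV[k]_n :=
  \row_i (v 0 i * w 0 i).

(** * The linear system spanned by F and the relations of S^F *)

Section NormalizedClifford.
Variables (k : fieldType) (n : nat) (F : n.-tuple 'M[k]_n).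
Hypotheses (k2 : 2%:R != 0 :> k).
Hypotheses (F_sym : symmetric_matrices F) (F_norm : normalized F).
Implicit Types (p q : proj k n) (u v w : 'rV[k]_n).

Definition clifford_form u : 'M[k]_n := \sum_m u 0 m *: tnth F m.

Lemma clifford_formZ (c : k) u : clifford_form (c *: u) = c *: clifford_form u.
Proof.
by rewrite /clifford_form scaler_sumr; apply: eq_bigr => m _; rewrite mxE scalerA.
Qed.

Lemma clifford_form_sym u : (clifford_form u)^T = clifford_form u.
Proof.
rewrite /clifford_form raddf_sum; apply: eq_bigr => m _.
by rewrite /= linearZ /= F_sym.
Qed.

(** Normalization enters here: as 2 is invertible, a matrix of the system determines its parameter
    [u]. *)
Lemma clifford_form_diag u i : clifford_form u i i = 2%:R * u 0 i.
Proof.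
rewrite summxE (bigD1 i) //= mxE F_norm eqxx big1 ?addr0 => [|m /negPf mi].
  by rewrite mulr1 mulrC.
by rewrite mxE F_norm mi !mulr0.
Qed.

Lemma sym_outer_clifford_form v w u :
  sym_outer v w = clifford_form u -> u = hadamard_row v w.
Proof.
move=> /matrixP E; apply/rowP => i; apply: (mulfI k2).
rewrite -clifford_form_diag -E sym_outerE mxE; by ring.
Qed.

Lemma fhomog_SF_rel (f : freeAlg k 'I_n) : SF_rel F f -> fhomog (fun=> 1%N) 2 f.
Proof.
case=> i j _; apply: fhomogD; first by apply: fhomogD; apply: fhomog_fvarM.
rewrite -scaleN1r; apply/fhomogZ/fhomog_sum => m; apply: fhomogZ.
exact: fhomog_fvarM.
Qed.

(** The relations give the entries above the diagonal; symmetry gives those below, and normalization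
    makes both diagonals equal to 2 v_i w_i. *)
Lemma SF_rel_zeroE v w :
  (forall f, SF_rel F f -> bilinear_value f v w = 0) <->
  sym_outer v w = clifford_form (hadamard_row v w).
Proof.
have relE i j : bilinear_value
    (fvar k i * fvar k j + fvar k j * fvar k i
     - \sum_(m < n) (tnth F m) i j *: (fvar k m) ^+ 2) v w
    = sym_outer v w i j - clifford_form (hadamard_row v w) i j.
  rewrite bilinear_valueB; congr (_ - _).
    rewrite bilinear_valueD sym_outerE [w 0 i * _]mulrC.
    by congr (_ + _); apply: bilinear_value_fvarM.
  rewrite bilinear_value_sum /clifford_form summxE; apply: eq_bigr => m _.
  rewrite bilinear_valueZ !mxE mulrC; congr (_ * _).
  exact: bilinear_value_fvarM.
split=> [H|H f [i j _]]; last by rewrite relE H subrr.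
have Hlt (i j : 'I_n) : (i < j)%N ->
    sym_outer v w i j = clifford_form (hadamard_row v w) i j.
  by move=> ij; apply/eqP; rewrite -subr_eq0 -relE H //.
apply/matrixP => i j; have [ij|ji|/val_inj <-] := ltngtP i j.
- exact: Hlt.
- transitivity (sym_outer v w j i); first by rewrite !sym_outerE; ring.
  by rewrite Hlt // -[in LHS]clifford_form_sym [LHS]mxE.
by rewrite clifford_form_diag sym_outerE mxE; ring.
Qed.

(** A zero product would give [sym_outer v w = 0], hence [v = 0] or [w = 0]. This makes p * sigma(p)
    a genuine point. *)
Lemma hadamard_row_neq0 v w : v != 0 -> w != 0 ->
  sym_outer v w = clifford_form (hadamard_row v w) -> hadamard_row v w != 0.
Proof.
move=> v0 w0 E; apply: contraNneq v0 => u0.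
have : sym_outer v w = 0.
  by rewrite E u0 -(scale0r (0 : 'rV_n)) clifford_formZ scale0r.
case/(sym_outer_eq0 k2) => [->|w00]; first exact: eqxx.
by rewrite w00 eqxx in w0.
Qed.

End NormalizedClifford.

Lemma hadamard_rowZ (k : fieldType) (n : nat) (b c : k) (v w : 'rV[k]_n) :
  hadamard_row (b *: v) (c *: w) = (b * c) *: hadamard_row v w.
Proof. by apply/rowP => i; rewrite !mxE mulrACA. Qed.

(** * The map p * sigma(p) and its fibres *)

Section Points.
Variables (k : fieldType) (n : nat) (F : n.-tuple 'M[k]_n).
Hypotheses (k2 : 2%:R != 0 :> k).
Hypotheses (F_sym : symmetric_matrices F) (F_norm : normalized F).
Variable sigma : proj k n -> proj k n.
Implicit Types (p q : proj k n) (v w : 'rV[k]_n).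

(** Computed from chosen coordinates to be total; [hadamard_pointP] gives independence of the choice
    where the Clifford condition holds. *)
Definition hadamard_point p : proj k n :=
  line_or p (hadamard_row (vpick (val p)) (vpick (val (sigma p)))).

Definition clifford_point p q := forall v w, hcoord p v -> hcoord q w ->
  sym_outer v w = clifford_form F (hadamard_row v w).

Lemma zero_locus_SF (B : lalgType k) (pi : freeAlg k 'I_n -> B) p q :
  presented_by pi (SF_rel F) -> zero_locus pi p q <-> clifford_point p q.
Proof.
move=> pres; rewrite (zero_locusE _ _ pres); last exact: fhomog_SF_rel.
split=> [H v w pv qw|H f Xf v w pv qw].
  by apply/(SF_rel_zeroE F_sym F_norm) => f Xf; apply: H.
exact: (SF_rel_zeroE F_sym F_norm v w).2 (H v w pv qw) f Xf.
Qed.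

Lemma hadamard_pointP p :
  clifford_point p (sigma p) -> is_hadamard p (sigma p) (hadamard_point p).
Proof.
move=> cl v w pv qw.
have [/andP [v0 _] /andP [w0 _]] := (pv, qw).
have u0 := hadamard_row_neq0 k2 v0 w0 (cl v w pv qw).
have [b vE] := hcoord_scale (hcoord_vpick p) pv.
have [c wE] := hcoord_scale (hcoord_vpick _) qw.
have uE : \row_i (v 0 i * w 0 i)
    = (b * c) *: hadamard_row (vpick (val p)) (vpick (val (sigma p))).
  by rewrite -hadamard_rowZ -vE -wE.
have := u0; rewrite /hadamard_row uE scaler_eq0 negb_or => /andP [bc0 h0].
by apply: hcoordZ => //; apply: hcoord_line_or.
Qed.

Lemma hadamard_point_rank p :
  clifford_point p (sigma p) -> rank_locus_pts F 3 (hadamard_point p).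
Proof.
move=> cl u; have [[v pv] [w qw]] := (hcoord_ex p, hcoord_ex (sigma p)).
move/(hcoord_scale (hadamard_pointP cl pv qw)) => [c ->].
rewrite -/(clifford_form F _) clifford_formZ -/(hadamard_row v w) -cl //.
by rewrite ltnS (leq_trans (mxrank_scale _ _)) ?rank_sym_outer.
Qed.

(** Equal images make the two symmetric matrices proportional, so by unique factorization the linear
    form of [q] is, up to a scalar, that of [p] or of [sigma p]. *)
Lemma hadamard_point_fibre p q :
    clifford_point p (sigma p) -> clifford_point q (sigma q) ->
  hadamard_point p = hadamard_point q -> q = p \/ q = sigma p.
Proof.
move=> clp clq E.
have [[v pv] [w sw]] := (hcoord_ex p, hcoord_ex (sigma p)).
have [[v' pv'] [w' sw']] := (hcoord_ex q, hcoord_ex (sigma q)).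
have zp := hadamard_pointP clp pv sw.
have zq := hadamard_pointP clq pv' sw'.
rewrite -E in zq; have [c cE] := hcoord_scale zq zp.
have v'0 : v' != 0 by case/andP: pv'.
have : sym_outer v w = c *: sym_outer v' w'.
  by rewrite clp // clq // -clifford_formZ; congr clifford_form.
case/(sym_outer_factor k2 v'0) => b b0 [d [e|e]]; [left|right].
  by apply/esym/(hcoord_collinear pv pv' b0 e).
by apply/esym/(hcoord_collinear sw pv' b0 e).
Qed.

End Points.

(** * Passage from S to A and the double cover *)

Theorem theorem4p17 (k : closedFieldType) (hk : [pchar k] =i pred0) (n r : nat)
    (* the normalized sequence F *)
    (F : n.-tuple 'M[k]_n) (F_sym : symmetric_matrices F) (F_free : free F)
    (F_norm : normalized F)
    (* S = S^F, an n-dimensional Clifford quantum polynomial algebra *)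
    (S : connGradedAlg k) (piS : {lrmorphism freeAlg k 'I_n -> S})
    (S_pres : graded_presentation (fun=> 1%N) piS (SF_rel F))
    (S_cqp : clifford_quantum_polynomial S n)
    (* A = S / (g_1^2, ..., g_r^2) *)
    (g : 'I_r -> S) (g_deg1 : forall i, cga_deg S 1 (g i))
    (g2_Z2 : forall i, central_elt (g i ^+ 2) /\ cga_deg S 2 (g i ^+ 2))
    (g2_reg : regular_sequence (fun i => g i ^+ 2))
    (A : algType k) (piA : {lrmorphism S -> A})
    (A_pres : presented_by piA (fun s => exists i, s = g i ^+ 2))
    (* g_i^2 = sum_j a_ij x_j^2 *)
    (a : 'M[k]_(r, n))
    (a_coef : forall i, g i ^+ 2 = \sum_(j < n) a i j *: piS (fvar k j) ^+ 2)
    (* the point varieties of S and A *)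
    (E_S E_A : variety k n) (sigma_S sigma_A : proj k n -> proj k n)
    (S_G1 : point_variety piS E_S sigma_S)
    (A_G1 : point_variety (fun f => piA (piS f)) E_A sigma_A) :
  exists Phi : proj k n -> proj k n,
    [/\ forall p, E_S p -> is_hadamard p (sigma_S p) (Phi p) /\ rank_locus F 3 (Phi p),
        forall p, E_A p -> E_S p
      & at_most_double_cover E_A (char_variety F a 3) Phi].
Proof.
have k2 : 2%:R != 0 :> k by have := hk 2; rewrite !inE /= => ->.
have [S_pres0 _] := S_pres.
(* Lifts of the g_i^2 to the free algebra, so that A is presented on the same variables as S. *)
pose sq_rel (f : freeAlg k 'I_n) :=
  exists i, f = \sum_(j < n) a i j *: (fvar k j * fvar k j).
have A_pres0 : presented_by (fun f => piA (piS f)) (fun f => SF_rel F f \/ sq_rel f).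
  have sqE i : piS (\sum_(j < n) a i j *: (fvar k j * fvar k j)) = g i ^+ 2.
    rewrite raddf_sum a_coef; apply: eq_bigr => j _.
    by rewrite /= linearZ /= rmorphM.
  apply: presented_by_comp S_pres0 A_pres _ => s; split=> [[i ->]|[f [i ->] <-]].
    by exists (\sum_(j < n) a i j *: (fvar k j * fvar k j)); [exists i|exact: sqE].
  by exists i; apply: sqE.
have hA f : SF_rel F f \/ sq_rel f -> fhomog (fun=> 1%N) 2 f.
  case=> [|[i ->]]; first exact: fhomog_SF_rel.
  by apply: fhomog_sum => j; apply: fhomogZ; apply: fhomog_fvarM.
have sq_val i v w :
    bilinear_value (\sum_(j < n) a i j *: (fvar k j * fvar k j)) v w
    = \sum_(j < n) a i j * hadamard_row v w 0 j.
  rewrite bilinear_value_sum; apply: eq_bigr => j _.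
  rewrite bilinear_valueZ mxE; congr (_ * _).
  exact: bilinear_value_fvarM.
have zA p q : zero_locus (fun f => piA (piS f)) p q <->
    clifford_point F p q /\ forall v w, hcoord p v -> hcoord q w ->
      forall i, \sum_(j < n) a i j * hadamard_row v w 0 j = 0.
  rewrite (zero_locusE _ _ A_pres0) // -(zero_locus_SF F_sym F_norm _ _ S_pres0).
  rewrite (zero_locusE _ _ S_pres0); last exact: fhomog_SF_rel.
  split=> [H|[H1 H2] f [Xf|[i ->]] v w pv qw].
  - split=> [f Xf|v w pv qw i]; first by apply: H; left.
    by rewrite -sq_val; apply: H => //; right; exists i.
  - exact: H1.
  by rewrite sq_val; apply: H2.
have [[[_ S_loc] _] S_zero] := S_G1; have [_ A_zero] := A_G1.
have ES_cl p : E_S p -> clifford_point F p (sigma_S p).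
  by move=> Ep; apply/(zero_locus_SF F_sym F_norm _ _ S_pres0)/S_zero.
(* The relations of A include those of S, so the graph of [sigma_A] lies in the graph of
   [sigma_S]. *)
have EA_ES p : E_A p -> E_S p /\ sigma_A p = sigma_S p.
  move=> Ep; have /zA [cl _] := (A_zero p (sigma_A p)).2 (conj Ep erefl).
  by apply/S_zero/(zero_locus_SF F_sym F_norm _ _ S_pres0).
have ES_had p := fun Ep => hadamard_pointP k2 (ES_cl p Ep).
exists (hadamard_point sigma_S); split=> [p Ep|p /EA_ES [] //|].
  by split; [apply: ES_had|apply: hadamard_point_rank (ES_cl p Ep)].
split.
- split=> [p EAp|p /EA_ES [ESp _]].
    have [ESp sigE] := EA_ES p EAp.
    split; first exact: hadamard_point_rank (ES_cl p ESp).
    have /zA [_ lin] := (A_zero p (sigma_A p)).2 (conj EAp erefl).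
    have [[v pv] [w qw]] := (hcoord_ex p, hcoord_ex (sigma_S p)).
    move=> u /(hcoord_scale (ES_had p ESp v w pv qw)) [c ->] i.
    have := lin v w pv; rewrite sigE => /(_ qw i) lin0.
    transitivity (c * \sum_(j < n) a i j * hadamard_row v w 0 j).
      by rewrite mulr_sumr; apply: eq_bigr => j _; rewrite mxE mulrCA.
    by rewrite lin0 mulr0.
  have [h [e [d [G [hh hp Gh GE]]]]] := S_loc p ESp.
  (* Multiplying the local forms [G j] of [sigma_S] by the coordinate x_j represents p * sigma_S(p),
     raising the degree by one. *)
  exists h, e, (1 + d)%N, (fun j => 'X_j * G j); split=> // [j|q v EAq qv hv].
    by apply: dhomogM (Gh j); rewrite dhomogX /= mpoly.mdeg1.
  have [ESq _] := EA_ES q EAq.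
  have := ES_had q ESq v _ qv (GE q v ESq qv hv).
  by congr hcoord; apply/rowP => j; rewrite !mxE mevalM mevalXU.
(* Surjectivity: a nonzero coordinate of [z] gives the nonzero diagonal entry needed to factor its
   matrix. *)
- move=> z [rz lz]; have [u zu] := hcoord_ex z.
  have /rV0Pn [i ui] : u != 0 by case/andP: zu.
  have Mii : clifford_form F u i i != 0.
    by rewrite clifford_form_diag // mulf_neq0.
  have rM : (\rank (clifford_form F u) <= 2)%N by rewrite -ltnS; apply: rz.
  have [v [w vwE]] := sym_rank2_factor k2 (clifford_form_sym F_sym u) rM Mii.
  have uE := sym_outer_clifford_form k2 F_norm (esym vwE).
  have v0 : v != 0.
    by apply: contraNneq ui => v0; rewrite uE v0 !mxE mul0r.
  have w0 : w != 0.
    by apply: contraNneq ui => w0; rewrite uE w0 !mxE mulr0.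
  (* The two linear factors serve as coordinates of a preimage [p] and of its image [q] under
     [sigma_A]. *)
  pose p := line_or z v; pose q := line_or z w.
  have [pv qw] : hcoord p v /\ hcoord q w by split; apply: hcoord_line_or.
  have /A_zero [EAp qE] : zero_locus (fun f => piA (piS f)) p q.
    apply/zA; split=> v' w' pv' qw'; have [[b ->] [c ->]] :=
      (hcoord_scale pv pv', hcoord_scale qw qw').
      by rewrite sym_outerZ hadamard_rowZ clifford_formZ -uE vwE.
    move=> j; rewrite hadamard_rowZ -uE.
    transitivity (b * c * \sum_(l < n) a j l * u 0 l); last by rewrite lz ?mulr0.
    by rewrite mulr_sumr; apply: eq_bigr => l _; rewrite mxE mulrCA.
  exists p => //; have [ESp sigE] := EA_ES p EAp.
  have qw' : hcoord (sigma_S p) w by rewrite -sigE -qE.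
  apply: hcoord_eq (ES_had p ESp v w pv qw') _.
  by rewrite -/(hadamard_row v w) -uE.
(* Both [p2] and [p3] lie in the set formed by [p1] and [sigma_S p1], so two of the three points
   coincide. *)
move=> p1 p2 p3 /EA_ES [E1 _] /EA_ES [E2 _] /EA_ES [E3 _] e12 e13.
have [->|->] := hadamard_point_fibre k2 (ES_cl _ E1) (ES_cl _ E2) e12.
  by constructor 1.
have [->|->] := hadamard_point_fibre k2 (ES_cl _ E1) (ES_cl _ E3) e13.
  by constructor 2.
by constructor 3.
Qed.
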